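(* Let $k$ be a positive integer, let $j\in\{1,\ldots,k\}$, let $G(x)=\sum_{a=1}^k x^a$, let $\phi$ be the unique positive real number with $\sum_{a=1}^k\phi^{-a}=1$, and let $\sigma=1/\phi$. For $n\ge 0$ let $F_n$ be the number of compositions of $n$ whose parts all lie in $\{1,\ldots,k\}$, let $C_{n,j}$ be the total number of occurrences of the part $j$ among all these compositions, and let $A_{n,j}=C_{n,j}/F_n$. Then there is a constant $A$ with $0<A<1$ such that \[ A_{n,j}=\frac{\phi^{1-j}}{G'(\sigma)}(n+1-j)+\frac{\phi^{-j}G''(\sigma)}{G'(\sigma)^2}+O(A^n). \]
   Context: A composition of a nonnegative integer $n$ is a finite sequence of positive integers summing to $n$; its entries are its parts ($0$ has only the empty composition). $G'$, $G''$ are derivatives of $G$. $f(n)=h(n)+O(A^n)$ means there exist $C,N>0$ with $|f(n)-h(n)|\le C A^n$ for all $n>N$. *)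

(* Defs.v *)
From mathcomp Require Import all_boot all_order all_algebra.
From mathcomp Require Import finmap.
From mathcomp Require Import all_classical all_reals.

Set Implicit Arguments.
Unset Strict Implicit.
Unset Printing Implicit Defensive.

Import Order.TTheory GRing.Theory Num.Theory.
Local Open Scope ring_scope.

Definition is_composition (n : nat) (s : seq nat) : bool :=
  all (fun a => (0 < a)%N) s && (sumn s == n).

Definition compositions_upto (k n : nat) : set (seq nat) :=
  [set s | is_composition n s && all (fun a => (1 <= a <= k)%N) s]%classic.

(* [fset_set] below returns the empty set on infinite sets; this fact rules
   that case out. *)
Lemma finite_compositions_upto (k n : nat) :
  finite_set (compositions_upto k n).
Proof.
suff [l lP] : exists l : seq (seq nat), forall s : seq nat,
    all (fun a => (0 < a)%N) s -> (sumn s <= n)%N -> s \in l.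
  apply: (@sub_finite_set _ _ [set` l]%classic); last exact: finite_seq.
  move=> s; rewrite /compositions_upto /= => /andP[/andP[s_gt0 /eqP s_sum] _].
  by apply: lP; rewrite // s_sum.
elim: n => [|n [l lP]].
  by exists [:: [::]] => -[|[|a] s].
exists ([::] :: [seq a :: s | a <- iota 0 n.+2, s <- l]) => -[|a s] //.
move=> /andP[a_gt0 s_gt0] le_as; rewrite in_cons; apply/orP; right.
apply/allpairsP; exists (a, s); split=> //.
  by rewrite mem_iota add0n ltnS (leq_trans (leq_addr _ _) le_as).
apply: lP => //; rewrite -ltnS; apply: leq_trans le_as.
by rewrite -add1n leq_add2r.
Qed.

Definition num_compositions (k n : nat) : nat :=
  #|` fset_set (compositions_upto k n) |%fset.

Definition num_occurrences (k j n : nat) : nat :=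
  (\sum_(s <- fset_set (compositions_upto k n)) count_mem j s)%N.

Definition avg_occurrences (R : realType) (k j n : nat) : R :=
  (num_occurrences k j n)%:R / (num_compositions k n)%:R.

Definition Gpoly (R : realType) (k : nat) : {poly R} :=
  \sum_(1 <= a < k.+1) 'X^a.

(* f(n) = h(n) + O(A^n) as n tends to infinity *)
Definition eq_up_to_O_geom (R : realType) (f h : nat -> R) (A : R) : Prop :=
  exists (C : R) (N : nat),
    [/\ 0 < C, (0 < N)%N &
      forall n : nat, (N < n)%N -> `|f n - h n| <= C * A ^+ n].

(* Main.v *)
(* Put p_a = phi^-a, a probability distribution on {1, ..., k}. Splitting a
   composition by its first part shows that f(n) = F_n phi^-n and
   g(n) = C_{n,j} phi^-n satisfy the renewal equations f = p * f + delta_0 and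
   g = p * g + p_j f(. - j). Convolving instead with the tails
   q_i = p_{i+1} + ... + p_k, that is, dividing by 1 - x, turns them into
   q * f = 1 and q * g = p_j (f(0) + ... + f(. - j)). An affine sequence solves
   such an equation with affine right-hand side, so everything reduces to: if
   (q * u)(n) = O(A^n) then u(n) = O(A^n). The latter holds because, for a small
   d > 0, u(n) is up to such an error a combination of u(n-1), ..., u(n-k) with
   the weights p_a - d q_{a-1}, which are nonnegative and have sum < 1. No
   information on the complex roots of 1 - G is needed. *)

Require Import Defs.
From mathcomp Require Import all_boot all_order all_algebra.
From mathcomp Require Import finmap.
From mathcomp Require Import all_classical all_reals.
From mathcomp Require Import ring lra zify.

Import Order.TTheory GRing.Theory Num.Theory.
Local Open Scope ring_scope.

(** * Recurrences for the counts, by removal of the first part *)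

Lemma mem_compositions_upto (k n : nat) (s : seq nat) :
  (s \in fset_set (compositions_upto k n)) =
  (sumn s == n) && all (fun a => (1 <= a <= k)%N) s.
Proof.
rewrite in_fset_set; last exact: finite_compositions_upto.
rewrite /compositions_upto /is_composition; apply/idP/idP => /=.
  by rewrite in_setE => /= /andP[/andP[_ ->] ->].
move=> /andP[sumE kP]; rewrite in_setE /= sumE kP !andbT.
by apply: sub_all kP => a /andP[].
Qed.

(** The weight [w] is arbitrary so that one bijection, [(a, s)] to [a :: s], serves both counts: [w]
    constantly 1 gives F_n and [count_mem j] gives C_{n,j}. *)
Lemma sum_compositions_uptoS (k n : nat) (w : seq nat -> nat) :
  (\sum_(s <- fset_set (compositions_upto k n.+1)) w s =
   \sum_(1 <= a < k.+1 | a <= n.+1)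
     \sum_(s <- fset_set (compositions_upto k (n.+1 - a))) w (a :: s))%N.
Proof.
pose l := [seq a :: s | a <- [seq a <- index_iota 1 k.+1 | a <= n.+1],
                        s <- fset_set (compositions_upto k (n.+1 - a))]%N.
have lP : perm_eq (fset_set (compositions_upto k n.+1)) l.
  apply: uniq_perm; first exact: fset_uniq.
    apply: allpairs_uniq_dep; first by rewrite filter_uniq // iota_uniq.
      by move=> a _; exact: fset_uniq.
    by move=> [a s] [b t] _ _ /= [-> ->].
  move=> s; rewrite mem_compositions_upto; apply/idP/allpairsPdep.
    case: s => [//|a s] /= /andP[/eqP sumE /andP[a_k s_k]].
    exists a, s; rewrite mem_filter mem_index_iota mem_compositions_upto s_k.
    by split=> //; lia.
  move=> [a [t [+ + ->]]] /=.
  rewrite mem_filter mem_index_iota mem_compositions_upto.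
  by move=> /andP[? ?] /andP[/eqP ? ->]; rewrite andbT; lia.
by rewrite (perm_big _ lP) big_allpairs_dep big_filter.
Qed.

Lemma num_compositions0 (k : nat) : num_compositions k 0 = 1%N.
Proof.
rewrite /num_compositions (_ : fset_set _ = [fset [::]])%fset ?cardfs1 //.
apply/fsetP => s; rewrite mem_compositions_upto inE.
by case: s => [//|[|a] s] //=; rewrite andbF.
Qed.

Lemma num_occurrences0 (k j : nat) : num_occurrences k j 0 = 0%N.
Proof.
rewrite /num_occurrences big_seq big1 // => s; rewrite mem_compositions_upto.
by case: s => [//|[|a] s] //=; rewrite andbF.
Qed.

Lemma num_compositionsS (k n : nat) :
  (num_compositions k n.+1 =
   \sum_(1 <= a < k.+1 | a <= n.+1) num_compositions k (n.+1 - a))%N.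
Proof.
rewrite /num_compositions -sum1_size sum_compositions_uptoS.
by apply: eq_bigr => a _; rewrite sum1_size.
Qed.

(** The last summand counts the first parts equal to [j]: one for each composition of [n.+1 - j].
    The guard matters because truncated subtraction would otherwise contribute compositions of 0. *)
Lemma num_occurrencesS (k j n : nat) : (1 <= j <= k)%N ->
  (num_occurrences k j n.+1 =
   \sum_(1 <= a < k.+1 | a <= n.+1) num_occurrences k j (n.+1 - a)
   + if j <= n.+1 then num_compositions k (n.+1 - j) else 0)%N.
Proof.
move=> jk; rewrite /num_occurrences sum_compositions_uptoS.
under eq_bigr do rewrite big_split /= addnC.
rewrite big_split /=; congr (_ + _)%N.
rewrite big_mkcond (bigD1_seq j) ?iota_uniq ?mem_index_iota //=.
rewrite eqxx sum1_size big1 ?addn0 // => a a_neqj.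
by rewrite (negbTE a_neqj) big1_eq if_same.
Qed.

(** * Tail weights and summation by parts *)

Definition tail_weight {R : realType} (p : nat -> R) (k i : nat) : R :=
  \sum_(i.+1 <= a < k.+1) p a.

Lemma tail_weightS {R : realType} (p : nat -> R) (k i : nat) : (i < k)%N ->
  tail_weight p k i = p i.+1 + tail_weight p k i.+1.
Proof. by move=> ik; rewrite /tail_weight big_ltn. Qed.

(* The shift by [k] keeps the subtraction of naturals from truncating. *)
Definition tail_conv {R : realType} (p : nat -> R) (k : nat) (u : nat -> R)
    (n : nat) : R :=
  \sum_(0 <= i < k) tail_weight p k i * u (n + k - i)%N.

(** Summation by parts. In the induction, raising [k] adds [p k.+1] to every tail, and these
    additions telescope. Besides [tail_convS], it yields the moments of the tails through W i = i
    and W i = i (i - 1). *)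
Lemma abel_tail_weight {R : realType} (p W : nat -> R) (k : nat) :
  \sum_(0 <= i < k) tail_weight p k i * (W i.+1 - W i) =
  \sum_(1 <= a < k.+1) p a * W a - tail_weight p k 0 * W 0%N.
Proof.
rewrite /tail_weight; elim: k => [|k IHk].
  by rewrite !big_geq // mul0r subr0.
rewrite big_nat_recr //= big_nat1 [X in _ = X - _]big_nat_recr //=.
rewrite [in X in _ = _ - X]big_nat_recr //=.
have -> : \sum_(0 <= i < k) (\sum_(i.+1 <= a < k.+2) p a) * (W i.+1 - W i) =
    \sum_(0 <= i < k) (\sum_(i.+1 <= a < k.+1) p a) * (W i.+1 - W i)
    + p k.+1 * (W k - W 0%N).
  rewrite -(telescope_sumr W) // mulr_sumr -big_split /=.
  apply: eq_big_nat => i /andP[_ ik]; rewrite -mulrDl.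
  by rewrite [in LHS]big_nat_recr //; lia.
rewrite IHk; ring.
Qed.

(** For the generating functions Q of the tails and P of [p], this is the identity (1 - x) Q(x) =
    q_0 - P(x). *)
Lemma tail_convS {R : realType} (p u : nat -> R) (k n : nat) :
  tail_conv p k u n.+1 - tail_conv p k u n =
  tail_weight p k 0 * u (n.+1 + k)%N
  - \sum_(1 <= a < k.+1) p a * u (n.+1 + k - a)%N.
Proof.
have := abel_tail_weight p (fun i => u (n.+1 + k - i)%N) k.
rewrite subn0 => abelE; rewrite -[RHS]opprB -abelE -sumrB -sumrN.
apply: eq_bigr => i _; rewrite -mulrBr -mulrN opprB.
by congr (_ * (u _ - u _)); lia.
Qed.

(** * Geometric decay of solutions *)

Lemma bernoulli_onem {R : realType} (x : R) (n : nat) : 0 <= x <= 1 ->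
  1 - n%:R * x <= (1 - x) ^+ n.
Proof.
move=> /andP[x_ge0 x_le1]; elim: n => [|n IHn]; first by rewrite mul0r subr0.
rewrite exprS -natr1.
have : (1 - x) * (1 - n%:R * x) <= (1 - x) * (1 - x) ^+ n.
  by apply: ler_wpM2l => //; lra.
have : 0 <= n%:R * (x * x) by rewrite !mulr_ge0.
move: (_ ^+ n) (n%:R) => y z ? ?; nra.
Qed.

Lemma mulrn_expr_le {R : realType} (A : R) (n : nat) : 0 < A < 1 ->
  n%:R * A ^+ n <= (1 - A)^-1.
Proof.
move=> /andP[A_gt0 A_lt1].
(* This stronger bound is inductive: its left side is nonincreasing in [n] and equals 1 at
   [n = 0]. *)
suff: (n%:R * (1 - A) + 1) * A ^+ n <= 1.
  have : 0 < A ^+ n by rewrite exprn_gt0.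
  move=> ? ?; rewrite -div1r ler_pdivlMr; [lra|lra].
elim: n => [|n IHn]; first by rewrite mul0r add0r mulr1.
apply: le_trans IHn; rewrite exprS mulrA ler_wpM2r ?exprn_ge0 ?(ltW A_gt0) //.
rewrite -natr1.
have : 0 <= n%:R * (1 - A) * (1 - A) by rewrite !mulr_ge0 // subr_ge0 ltW.
have : 0 <= (1 - A) * (1 - A) by rewrite !mulr_ge0 // subr_ge0 ltW.
by move: (n%:R) => z ? ?; lra.
Qed.

Lemma tail_conv_decay {R : realType} (p : nat -> R) (k : nat) (d : R) :
  (0 < k)%N -> 0 < d -> (forall a, (1 <= a <= k)%N -> d <= p a) ->
  \sum_(1 <= a < k.+1) p a = 1 ->
  exists A : R, 0 < A < 1 /\
    forall (u : nat -> R) (K : R),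
      (forall n, `|tail_conv p k u n| <= K * A ^+ n) ->
      exists C : R, forall n, `|u n| <= C * A ^+ n.
Proof.
move=> k_gt0 d_gt0 d_le p_sum1.
pose q := tail_weight p k; pose mu := \sum_(0 <= i < k) q i.
have q0 : q 0%N = 1 by [].
have q_ge0 i : 0 <= q i.
  rewrite /q /tail_weight big_seq sumr_ge0 // => a.
  by rewrite mem_index_iota => ?; apply: le_trans (d_le _ _); [exact: ltW|lia].
have q_le1 i : (i <= k)%N -> q i <= 1.
  elim: i => [|i IHi] ik; first by rewrite q0.
  apply: le_trans (IHi (ltnW ik)); rewrite /q [leRHS]tail_weightS // lerDr.
  by apply: le_trans (d_le _ _); [exact: ltW|lia].
have mu_ge1 : 1 <= mu.
  by rewrite /mu big_ltn // q0 lerDl sumr_ge0.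
(* Here d q_{a-1} <= d <= p_a, since the tails are at most 1. *)
have w_ge0 a : (1 <= a <= k)%N -> 0 <= p a - d * q a.-1.
  move=> ak; rewrite subr_ge0; apply: le_trans (d_le _ ak).
  by rewrite ler_piMr ?q_le1 //; [exact: ltW|lia].
have muE : \sum_(1 <= a < k.+1) q a.-1 = mu.
  by rewrite big_add1.
have w_sum : \sum_(1 <= a < k.+1) (p a - d * q a.-1) = 1 - d * mu.
  by rewrite sumrB p_sum1 -mulr_sumr muE.
have tau_le1 : d * mu <= 1.
  rewrite -subr_ge0 -w_sum big_seq sumr_ge0 // => a.
  by rewrite mem_index_iota; exact: w_ge0.
have tau_gt0 : 0 < d * mu by rewrite mulr_gt0 //; lra.
set tau := d * mu in w_sum tau_le1 tau_gt0.
have kR : 1 <= k%:R :> R by rewrite ler1n.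
(* The weights sum to 1 - tau. Half of that gain is spent on the [k] steps back: with x = tau /
   (2k), Bernoulli gives A^k >= 1 - tau/2. The choice does not depend on [u]. *)
have [x [xE x_gt0 x_lt1]] : exists x, [/\ k%:R * x = tau / 2, 0 < x & x < 1].
  exists (tau / (2 * k%:R)); split; first by field; lra.
    by rewrite divr_gt0 ?mulr_gt0 //=; lra.
  by rewrite ltr_pdivrMr; lra.
pose A : R := 1 - x.
have A_gt0 : 0 < A by rewrite /A; lra.
have A_lt1 : A < 1 by rewrite /A; lra.
have Ak : 1 - tau / 2 <= A ^+ k.
  by rewrite -xE; apply: bernoulli_onem; rewrite !ltW.
exists A; split; first by rewrite A_gt0.
move=> u K uK.
have K_ge0 : 0 <= K.
  by have := uK 0%N; rewrite mulr1; apply: le_trans.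
(* The sum covers the initial indices 0, ..., k. The last term makes C A tau >= 4 K, so that the
   error 2 K A^n fits into the other half of the gain, (tau/2) C A^(n+1). *)
pose C := \sum_(0 <= i < k.+1) `|u i| / A ^+ i + 4 * K / (A * tau).
have C0_ge0 i : 0 <= `|u i| / A ^+ i.
  by rewrite divr_ge0 // exprn_ge0 // ltW.
have C1_ge0 : 0 <= 4 * K / (A * tau).
  by rewrite divr_ge0 ?(mulr_ge0 _ K_ge0) ?(ltW (mulr_gt0 A_gt0 tau_gt0)).
have C_ge : 4 * K <= C * (A * tau).
  by rewrite -ler_pdivrMr ?(mulr_gt0 A_gt0 tau_gt0) // /C lerDr sumr_ge0.
have C_ge0 : 0 <= C by rewrite addr_ge0 // sumr_ge0.
exists C => m; elim/ltn_ind: m => m IHm.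
have [mk|km] := leqP m k.
  rewrite -ler_pdivrMr ?exprn_gt0 // /C.
  rewrite (bigD1_seq m) ?iota_uniq ?mem_index_iota //=.
  by rewrite -addrA lerDl addr_ge0 // sumr_ge0.
have [n mE] : exists n, m = (n.+1 + k)%N.
  by exists (m - k.+1)%N; rewrite addSnnS subnK.
(* Solve [tail_convS] for [u m], where q_0 = 1, then trade d times the convolution at [n] for the
   weights d q_{a-1}: that convolution only involves u(m-1), ..., u(m-k). *)
have uE : u m = \sum_(1 <= a < k.+1) (p a - d * q a.-1) * u (m - a)%N
    + (tail_conv p k u n.+1 - (1 - d) * tail_conv p k u n).
  have := tail_convS p u k n; rewrite -/(q 0%N) q0 -mE mul1r.
  have -> : \sum_(1 <= a < k.+1) (p a - d * q a.-1) * u (m - a)%N =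
      \sum_(1 <= a < k.+1) p a * u (m - a)%N - d * tail_conv p k u n.
    have -> : tail_conv p k u n =
        \sum_(1 <= a < k.+1) q a.-1 * u (n + k - a.-1)%N by rewrite big_add1.
    rewrite mulr_sumr -sumrB.
    apply: eq_big_nat => -[//|a] ak; rewrite mulrBl mulrA.
    by rewrite mE addSn subSS.
  move=> /(canRL (subrK _)) ->; ring.
have d_le1 : d <= 1.
  apply: le_trans tau_le1; rewrite /tau ler_peMr //; exact: ltW.
have main : `|u m| <= (1 - tau) * (C * A ^+ n.+1) + 2 * (K * A ^+ n).
  rewrite uE; apply: (le_trans (ler_normD _ _)); apply: lerD.
    rewrite -w_sum mulr_suml; apply: le_trans (ler_norm_sum _ _ _) _.
    rewrite big_seq [leRHS]big_seq; apply: ler_sum => a.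
    rewrite mem_index_iota => ak; rewrite normrM ger0_norm ?w_ge0 //.
    apply: ler_wpM2l; first exact: w_ge0.
    have [a_gt0 a_le] := andP ak.
    apply: le_trans (IHm _ _) _.
      by rewrite ltn_subrL a_gt0 (ltn_trans k_gt0).
    apply: ler_wpM2l => //; apply: ler_wiXn2l; [exact: ltW|exact: ltW|].
    by rewrite mE -addnBA // leq_addr.
  have An1 : A ^+ n.+1 <= A ^+ n by apply: ler_wiXn2l; rewrite ?ltW.
  have uK0 := uK n; have uK1 := uK n.+1.
  have KA : K * A ^+ n.+1 <= K * A ^+ n by apply: ler_wpM2l.
  apply: le_trans (ler_normB _ _) _; rewrite normrM.
  have : `|1 - d| * `|tail_conv p k u n| <= `|tail_conv p k u n|.
    by rewrite ler_piMl // ger0_norm; lra.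
  move=> ?; lra.
apply: le_trans main _; rewrite mE exprD.
have An : 0 < A ^+ n by rewrite exprn_gt0.
have ineq1 : 4 * K * A ^+ n <= C * (A * tau) * A ^+ n.
  by apply: ler_wpM2r => //; exact: ltW.
have ineq2 : C * A ^+ n.+1 * (1 - tau / 2) <= C * A ^+ n.+1 * A ^+ k.
  by apply: ler_wpM2l => //; rewrite mulr_ge0 // exprn_ge0 // ltW.
rewrite [leRHS]mulrA; apply: le_trans ineq2; rewrite exprS.
by move: (A ^+ n) ineq1 => y ?; lra.
Qed.

(** * Affine solutions and renewal equations in convolution form *)

Lemma tail_convB {R : realType} (p u v : nat -> R) (k n : nat) :
  tail_conv p k (fun m => u m - v m) n = tail_conv p k u n - tail_conv p k v n.
Proof. by rewrite /tail_conv -sumrB; under eq_bigr do rewrite mulrBr. Qed.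

(** Supplies the explicit solutions that are subtracted from the padded sequences before
    [tail_conv_decay] is applied. *)
Lemma tail_conv_affine {R : realType} (p : nat -> R) (k : nat) (x y : R)
    (n : nat) :
  tail_conv p k (fun m => x * m%:R + y) n =
  (x * (n + k)%:R + y) * (\sum_(0 <= i < k) tail_weight p k i)
  - x * (\sum_(0 <= i < k) tail_weight p k i * i%:R).
Proof.
rewrite !mulr_sumr -sumrB; apply: eq_big_nat => i ik.
rewrite natrB; last by lia.
ring.
Qed.

(* A sequence on [nat] extended by zero to the indices [-k, ..., -1], which are
   then shifted to [0, ..., k-1]. *)
Definition pad {R : realType} (k : nat) (u : nat -> R) (n : nat) : R :=
  if (n < k)%N then 0 else u (n - k)%N.

Lemma padD {R : realType} (k : nat) (u : nat -> R) (n : nat) :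
  pad k u (n + k) = u n.
Proof. by rewrite /pad addnK ltnNge leq_addl. Qed.

Lemma tail_conv_pad0 {R : realType} (p u : nat -> R) (k : nat) : (0 < k)%N ->
  tail_conv p k (pad k u) 0 = tail_weight p k 0 * u 0%N.
Proof.
move=> k_gt0; rewrite /tail_conv big_ltn // subn0 padD big_nat big1 ?addr0 //.
by move=> i ik; rewrite /pad ifT ?mulr0 //; lia.
Qed.

(** By [tail_convS] and q_0 = 1, the increment of the convolution at [n.+1] is exactly [v n.+1]. At
    0 the padding leaves only the term of index 0, which is [u 0 = v 0]. *)
Lemma tail_conv_renewal {R : realType} (p u v : nat -> R) (k : nat) :
  (0 < k)%N -> \sum_(1 <= a < k.+1) p a = 1 ->
  (forall n, u n = \sum_(1 <= a < k.+1 | (a <= n)%N) p a * u (n - a)%N + v n) ->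
  forall n, tail_conv p k (pad k u) n = \sum_(0 <= m < n.+1) v m.
Proof.
move=> k_gt0 q0 uE.
elim=> [|n IHn].
  rewrite tail_conv_pad0 // [tail_weight _ _ _]q0 mul1r uE big_nat1.
  by rewrite big_nat_cond big_pred0 ?add0r // => a; lia.
rewrite big_nat_recr //= -IHn; apply/eqP; rewrite addrC -subr_eq tail_convS.
rewrite [tail_weight _ _ _]q0 mul1r padD uE.
rewrite subr_eq addrC (inj_eq (addrI _)) big_mkcond /=.
apply/eqP/eq_big_nat => a ak; have [an|na] := leqP a n.+1.
  have -> : (n.+1 + k - a = n.+1 - a + k)%N by lia.
  by rewrite padD.
by rewrite /pad ifT ?mulr0 //; lia.
Qed.

Lemma tail_conv_pad_sum {R : realType} (p u : nat -> R) (k : nat) :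
  (0 < k)%N ->
  forall n, tail_conv p k (pad k (fun m => \sum_(0 <= i < m.+1) u i)) n =
  \sum_(0 <= m < n.+1) tail_conv p k (pad k u) m.
Proof.
move=> k_gt0; elim=> [|n IHn].
  by rewrite big_nat1 !tail_conv_pad0 // big_nat1.
rewrite big_nat_recr //= -IHn; apply/eqP; rewrite addrC -subr_eq /tail_conv.
rewrite -sumrB; apply/eqP/eq_big_nat => i ik; rewrite -mulrBr.
have -> : (n.+1 + k - i = (n + k - i).+1)%N by lia.
congr (_ * _); move: (n + k - i)%N => m; rewrite /pad.
have [mk|mk] := ltnP m.+1 k; first by rewrite ifT ?subrr //; lia.
(* At the boundary m + 1 = k the padded partial sum jumps from 0 to [u 0]. *)
have [mk'|mk'] := ltnP m k.
  have -> : m.+1 = k by lia.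
  by rewrite subnn big_nat1 subr0.
by rewrite subSn // big_nat_recr //= addrC addrK.
Qed.

Lemma sum_pad {R : realType} (u : nat -> R) (j n : nat) :
  \sum_(0 <= m < n.+1) pad j u m =
  pad j (fun m => \sum_(0 <= i < m.+1) u i) n.
Proof.
rewrite /pad; have [nj|jn] := ltnP n j.
  by rewrite big_nat big1 // => m mn; rewrite ifT //; lia.
rewrite (big_cat_nat (n := j)) //=; last by lia.
rewrite big_nat big1 ?add0r; last by move=> m /andP[_ ->].
rewrite -{1}[j]add0n big_addn subSn //.
by apply: eq_bigr => m _; rewrite addnK ltnNge leq_addl.
Qed.

(** * Lower bound for f and asymptotics of g / f *)

Lemma renewal_ge {R : realType} (p f : nat -> R) (k : nat) (d : R) :
  (0 < k)%N -> 0 < d -> (forall a, (1 <= a <= k)%N -> d <= p a) ->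
  \sum_(1 <= a < k.+1) p a = 1 ->
  (forall n, f n = \sum_(1 <= a < k.+1 | (a <= n)%N) p a * f (n - a)%N
                   + (n == 0)%:R) ->
  forall n, d ^+ k <= f n.
Proof.
move=> k_gt0 d_gt0 d_le p_sum1 fE.
have p_gt0 a : (1 <= a < k.+1)%N -> 0 < p a.
  by move=> ak; apply: lt_le_trans (d_le _ _).
have f_ge0 n : 0 <= f n.
  elim/ltn_ind: n => n IHn; rewrite fE addr_ge0 // big_nat_cond sumr_ge0 //.
  move=> a /andP[ak an]; rewrite mulr_ge0 ?IHn ?(ltW (p_gt0 _ _)) //; lia.
have d_le1 : d <= 1.
  rewrite -p_sum1 big_ltn //; apply: le_trans (d_le 1%N _) _; first by lia.
  rewrite lerDl big_nat sumr_ge0 // => a ak; rewrite ltW // p_gt0 //; lia.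
(* Keep only the term [a = 1]. Iterating gives d^n <= f(n), which suffices up to [n = k]. *)
have f_step n : d * f n <= f n.+1.
  rewrite [leRHS]fE addr0 big_mkcond big_ltn //= subn1 /=.
  rewrite -[leLHS]addr0 lerD ?ler_wpM2r ?d_le //.
  rewrite big_nat sumr_ge0 // => a ak; case: ifP => // _.
  by rewrite mulr_ge0 // ltW // p_gt0 //; lia.
have f_small n : d ^+ n <= f n.
  elim: n => [|n IHn].
    by rewrite fE big_nat_cond big_pred0 ?add0r // => a; lia.
  by rewrite exprS; apply: le_trans (f_step n); rewrite ler_wpM2l // ltW.
elim/ltn_ind => n IHn; have [nk|kn] := leqP n k.
  by apply: le_trans (f_small n); apply: ler_wiXn2l => //; exact: ltW.
(* Beyond [k] every [a] satisfies [a <= n], so f(n) is a full weighted average of the [k] preceding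
   values and inherits their lower bound. *)
rewrite fE -[leLHS]mul1r -[in leLHS]p_sum1 mulr_suml -[leLHS]addr0 lerD //.
rewrite big_nat [leRHS]big_nat_cond.
rewrite [leRHS](eq_bigl (fun a => 1 <= a < k.+1)%N); last by move=> a; lia.
by apply: ler_sum => a ak; rewrite ler_wpM2l ?IHn ?(ltW (p_gt0 _ _)) //; lia.
Qed.

(** With errors O(A^n), f tends to c = 1/mu and g is c h for the affine h of the conclusion. As h
    grows linearly, the quotient costs a factor n, absorbed by a larger base. The term [pad j f n]
    stands for f(n-j), zero when n < j. *)
Lemma renewal_ratio {R : realType} (p f g : nat -> R) (k j : nat) (d : R) :
  (0 < k)%N -> (1 <= j <= k)%N ->
  0 < d -> (forall a, (1 <= a <= k)%N -> d <= p a) ->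
  \sum_(1 <= a < k.+1) p a = 1 ->
  (forall n, f n = \sum_(1 <= a < k.+1 | (a <= n)%N) p a * f (n - a)%N
                   + (n == 0)%:R) ->
  (forall n, g n = \sum_(1 <= a < k.+1 | (a <= n)%N) p a * g (n - a)%N
                   + p j * pad j f n) ->
  let mu := \sum_(0 <= i < k) tail_weight p k i in
  let nu := \sum_(0 <= i < k) tail_weight p k i * i%:R in
  exists (A C : R), 0 < A < 1 /\ forall n,
    `|g n / f n - (p j / mu * (n%:R + 1 - j%:R) + 2 * p j * nu / mu ^+ 2)|
      <= C * A ^+ n.
Proof.
move=> k_gt0 jk d_gt0 d_le p_sum1 fE gE mu nu.
have [A [/andP[A_gt0 A_lt1] decay]] :=
  tail_conv_decay p k d k_gt0 d_gt0 d_le p_sum1.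
have mu_gt0 : 0 < mu.
  rewrite /mu big_ltn // /tail_weight p_sum1 ltr_wpDr // sumr_ge0 // => i _.
  rewrite big_nat sumr_ge0 // => a ak; apply: le_trans (d_le _ _); last by lia.
  exact: ltW.
have mu_neq0 : mu != 0 by rewrite gt_eqF.
pose c := mu^-1; pose S := c ^+ 2 * nu.
pose s n := \sum_(0 <= m < n.+1) f m.
have Qf n : tail_conv p k (pad k f) n = 1.
  rewrite (tail_conv_renewal p f (fun n => (n == 0)%:R)) //.
  by rewrite big_ltn // big_nat big1 ?addr0 // => -[|m].
have Qs n : tail_conv p k (pad k s) n = n.+1%:R.
  rewrite tail_conv_pad_sum //; under eq_bigr do rewrite Qf.
  by rewrite sumr_const_nat subn0.
have Qg n : tail_conv p k (pad k g) n = p j * pad j s n.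
  rewrite (tail_conv_renewal p g (fun n => p j * pad j f n)) //.
  by rewrite -mulr_sumr sum_pad.
have [Cf fc] : exists C, forall n, `|f n - c| <= C * A ^+ n.
  have [n|C CP] := decay (fun m => pad k f m - (0 * m%:R + c)) 0.
    rewrite tail_convB Qf tail_conv_affine -/mu -/nu /c.
    by rewrite !mul0r add0r subr0 mulVf // subrr normr0.
  exists (C * A ^+ k) => n; rewrite -mulrA -exprD addnC.
  by have := CP (n + k)%N; rewrite padD mul0r add0r.
(* The affine sequence solves q * s = n + 1 exactly, hence the bound 0 in the hypothesis of
   [decay]. *)
have [Cs sc] : exists C, forall n,
    `|pad k s n - (c * n%:R + (c * (1 - k%:R) + S))| <= C * A ^+ n.
  apply: (decay _ 0) => n; rewrite tail_convB Qs tail_conv_affine.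
  rewrite -/mu -/nu /S /c.
  rewrite natrD -natr1 [X in `|X|](_ : _ = 0) ?normr0 ?mul0r //.
  by field.
have Cs_ge0 : 0 <= Cs.
  by have := sc 0%N; rewrite mulr1; apply: le_trans.
pose h (n : nat) := p j * c * (n%:R + 1 - j%:R) + 2 * p j * S.
(* The right-hand side p_j s(n-j) is itself affine only up to O(A^n). Inverting q twice, once for s
   and once for g, produces the factor 2 before S. *)
have [Cg gc] : exists C, forall n, `|g n - c * h n| <= C * A ^+ n.
  have [n|C CP] := decay (fun m => pad k g m -
      (p j * c ^+ 2 * m%:R
       + (p j * c * (c * (1 - k%:R - j%:R) + 2 * S)))) (`|p j| * Cs).
    rewrite tail_convB Qg tail_conv_affine -/mu -/nu.
    have -> : pad j s n = pad k s (n + k - j)%N.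
      rewrite /pad; have [nj|jn] := ltnP n j; first by rewrite ifT //; lia.
      by rewrite ifF; [congr s|]; lia.
    rewrite [X in `|X|](_ : _ = p j * (pad k s (n + k - j)%N -
        (c * (n + k - j)%:R + (c * (1 - k%:R) + S)))); last first.
      by rewrite natrB ?natrD /S /c; [field|lia].
    rewrite normrM -mulrA; apply: ler_wpM2l => //.
    apply: le_trans (sc _) _; apply: ler_wpM2l => //.
    by apply: ler_wiXn2l; [exact: ltW|exact: ltW|lia].
  exists (C * A ^+ k) => n; rewrite -mulrA -exprD addnC.
  have := CP (n + k)%N; rewrite padD natrD /h.
  rewrite [X in `|X|](_ : _ = g n - c *
    (p j * c * (n%:R + 1 - j%:R) + 2 * p j * S)) //.
  by ring.
have f_ge n := renewal_ge p f k d k_gt0 d_gt0 d_le p_sum1 fE n.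
have dk_gt0 : 0 < d ^+ k by rewrite exprn_gt0.
(* By the arithmetic-geometric mean inequality A <= B^2, so n A^n <= (n B^n) B^n <= B^n / (1 -
   B). *)
pose B := (1 + A) / 2.
have B_gt0 : 0 < B by rewrite /B; lra.
have B_lt1 : B < 1 by rewrite /B; lra.
have AB : A <= B * B by rewrite /B; nra.
have ABn n : A ^+ n <= B ^+ n * B ^+ n.
  by rewrite -exprMn; apply: lerXn2r => //; rewrite nnegrE; nra.
pose al := p j * c; pose be := p j * c * (1 - j%:R) + 2 * p j * S.
have hE n : h n = al * n%:R + be by rewrite /h /al /be; ring.
exists B, ((Cg + Cf * (`|al| / (1 - B) + `|be|)) / d ^+ k).
rewrite B_gt0; split=> // n.
have fn_gt0 : 0 < f n := lt_le_trans dk_gt0 (f_ge n).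
have -> : g n / f n - (p j / mu * (n%:R + 1 - j%:R) + 2 * p j * nu / mu ^+ 2) =
    (g n - c * h n - (f n - c) * h n) / f n.
  by rewrite /h /S /c; field; rewrite gt_eqF.
rewrite normrM normfV (gtr0_norm fn_gt0) mulrAC.
have Bn_ge0 : 0 <= B ^+ n by rewrite exprn_ge0 // ltW.
have Bn_le1 : B ^+ n <= 1 by rewrite exprn_ile1 // ltW.
have ABn1 : A ^+ n <= B ^+ n by apply: le_trans (ABn n) _; rewrite ler_piMl.
have Cf_ge0 : 0 <= Cf.
  by have := fc 0%N; rewrite mulr1; apply: le_trans.
have Cg_ge0 : 0 <= Cg.
  by have := gc 0%N; rewrite mulr1; apply: le_trans.
have nBn : n%:R * A ^+ n <= (1 - B)^-1 * B ^+ n.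
  have := mulrn_expr_le B n; rewrite B_gt0 B_lt1 => /(_ isT) nB.
  apply: (@le_trans _ _ (n%:R * B ^+ n * B ^+ n)); last by rewrite ler_wpM2r.
  by rewrite -mulrA ler_wpM2l.
have hn : `|h n| <= `|al| * n%:R + `|be|.
  by rewrite hE (le_trans (ler_normD _ _)) // normrM normr_nat.
have num_le : `|g n - c * h n - (f n - c) * h n| <=
    (Cg + Cf * (`|al| / (1 - B) + `|be|)) * B ^+ n.
  apply: le_trans (ler_normB _ _) _; rewrite [leRHS]mulrDl; apply: lerD.
    by apply: le_trans (gc n) _; rewrite ler_wpM2l.
  rewrite normrM -mulrA.
  apply: (@le_trans _ _ (Cf * A ^+ n * (`|al| * n%:R + `|be|))).
    by apply: ler_pM.
  rewrite -mulrA ler_wpM2l // mulrDr [leRHS]mulrDl; apply: lerD.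
    by rewrite mulrCA -mulrA ler_wpM2l // mulrC.
  by rewrite mulrC ler_wpM2l.
apply: (@le_trans _ _ (`|g n - c * h n - (f n - c) * h n| / d ^+ k)).
  by rewrite ler_wpM2l // lef_pV2 ?posrE.
by rewrite ler_wpM2r // invr_ge0 ltW.
Qed.

(** * Moments of the tail weights and derivatives of G *)

Lemma sum_derivX_Gpoly {R : realType} (k : nat) (x : R) :
  \sum_(1 <= a < k.+1) a%:R * x ^+ a = x * ((Gpoly R k)^`()).[x].
Proof.
rewrite /Gpoly raddf_sum /= horner_sum mulr_sumr.
apply: eq_big_nat => -[//|a] _.
by rewrite derivXn hornerMn hornerXn mulr_natl exprS mulrnAr.
Qed.

Lemma sum_deriv2X_Gpoly {R : realType} (k : nat) (x : R) :
  \sum_(1 <= a < k.+1) (a * a.-1)%:R * x ^+ a =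
  x ^+ 2 * ((Gpoly R k)^`()^`()).[x].
Proof.
rewrite /Gpoly !raddf_sum /= horner_sum mulr_sumr.
apply: eq_big_nat => -[//|[|a]] _; rewrite derivXn.
  by rewrite mul0r expr0 mulr1n derivC horner0 mulr0.
rewrite derivMn derivXn !hornerMn hornerXn -mulrnA mulrnAr mulr_natl -exprD.
by rewrite mulnC.
Qed.

Lemma sum_tail_weight {R : realType} (p : nat -> R) (k : nat) :
  \sum_(0 <= i < k) tail_weight p k i = \sum_(1 <= a < k.+1) a%:R * p a.
Proof.
have := abel_tail_weight p (fun i => i%:R) k; rewrite mulr0 subr0.
under [in X in _ = X -> _]eq_bigr do rewrite mulrC.
by move=> <-; apply: eq_bigr => i _; rewrite -natr1 addrC addKr mulr1.
Qed.

(** The differences of i (i - 1) are 2 i, which explains the factor 2. *)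
Lemma sum_tail_weight_index {R : realType} (p : nat -> R) (k : nat) :
  2 * \sum_(0 <= i < k) tail_weight p k i * i%:R =
  \sum_(1 <= a < k.+1) (a * a.-1)%:R * p a.
Proof.
have := abel_tail_weight p (fun i => (i * i.-1)%:R) k; rewrite mulr0 subr0.
under [in X in _ = X -> _]eq_bigr do rewrite mulrC.
move=> <-; rewrite mulr_sumr; apply: eq_bigr => -[|i] _ /=.
  by rewrite !mulr0n subr0 !mulr0.
rewrite !natrM -!natr1; ring.
Qed.

Theorem theorem4p9 (R : realType) (k : nat) (hk : (0 < k)%N)
  (j : nat) (hj : (1 <= j <= k)%N)
  (phi : R) (hphi0 : 0 < phi)
  (hphi : \sum_(1 <= a < k.+1) phi ^- a = 1) :
  let G : {poly R} := Gpoly R k in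
  let sigma : R := 1 / phi in
  exists A : R, 0 < A /\ A < 1 /\
    eq_up_to_O_geom
      (fun n : nat => avg_occurrences R k j n)
      (fun n : nat =>
         phi ^ (1 - j%:Z) / (G^`()).[sigma] * (n%:R + 1 - j%:R)
         + phi ^ (- j%:Z) * (G^`()^`()).[sigma] / (G^`()).[sigma] ^+ 2)
      A.
Proof.
move=> G sigma.
have sigmaE : sigma = phi^-1 by rewrite /sigma div1r.
have phi_neq0 : phi != 0 by rewrite gt_eqF.
have sigma_gt0 : 0 < sigma by rewrite sigmaE invr_gt0.
have pE a : phi ^- a = sigma ^+ a by rewrite sigmaE exprVn.
pose p a := sigma ^+ a.
have p_sum1 : \sum_(1 <= a < k.+1) p a = 1.
  by rewrite -hphi; apply: eq_bigr => a _; rewrite pE.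
have sigma_le1 : sigma <= 1.
  rewrite -p_sum1 big_ltn // /p expr1 lerDl sumr_ge0 // => a _.
  by rewrite exprn_ge0 // ltW.
have p_ge a : (1 <= a <= k)%N -> sigma ^+ k <= p a.
  by move=> /andP[_ ak]; apply: ler_wiXn2l => //; exact: ltW.
pose f n : R := (num_compositions k n)%:R * sigma ^+ n.
pose g n : R := (num_occurrences k j n)%:R * sigma ^+ n.
(* Multiplication by sigma^n = sigma^a sigma^(n-a) turns the integer recurrences into renewal
   equations with weights [p a]. *)
have scaled (u : nat -> nat) n :
    (\sum_(1 <= a < k.+1 | (a <= n)%N) u (n - a)%N)%:R * sigma ^+ n =
    \sum_(1 <= a < k.+1 | (a <= n)%N)
      p a * ((u (n - a)%N)%:R * sigma ^+ (n - a)).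
  rewrite natr_sum mulr_suml; apply: eq_bigr => a an.
  by rewrite /p mulrCA -exprD subnKC.
have sum0 (v : nat -> R) : \sum_(1 <= a < k.+1 | (a <= 0)%N) v a = 0.
  by rewrite big_nat_cond big_pred0 // => a; lia.
have fE n : f n = \sum_(1 <= a < k.+1 | (a <= n)%N) p a * f (n - a)%N
    + (n == 0)%:R.
  case: n => [|n]; first by rewrite sum0 add0r /f num_compositions0 mulr1.
  by rewrite addr0 /f num_compositionsS scaled.
have gE n : g n = \sum_(1 <= a < k.+1 | (a <= n)%N) p a * g (n - a)%N
    + p j * pad j f n.
  case: n => [|n].
    rewrite sum0 add0r /g num_occurrences0 mul0r /pad ifT ?mulr0 //.
    by case/andP: hj.
  rewrite /g num_occurrencesS // natrD mulrDl scaled; congr (_ + _).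
  rewrite /pad /f ltnNge; case: leqP => jn /=; last by rewrite mul0r mulr0.
  by rewrite /p mulrCA -exprD subnKC.
(* Since sigma <= 1, the least weight is p_k = sigma^k, which serves as [d]. *)
have [A [C [/andP[A_gt0 A_lt1] ratio]]] :=
  renewal_ratio p f g k j (sigma ^+ k) hk hj (exprn_gt0 k sigma_gt0) p_ge
    p_sum1 fE gE.
exists A; split=> //; split=> //; exists (`|C| + 1), 1%N.
split=> // [|n _]; first by rewrite ltr_wpDl.
have An_ge0 : 0 <= A ^+ n by rewrite exprn_ge0 // ltW.
have : C * A ^+ n <= (`|C| + 1) * A ^+ n.
  by rewrite ler_wpM2r // (le_trans (ler_norm C)) // lerDl.
apply: le_trans; apply: le_trans (ratio n).
have -> : g n / f n = avg_occurrences R k j n.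
  by rewrite /f /g -mulf_div divff ?mulr1 // gt_eqF // exprn_gt0.
have muE := sum_tail_weight p k; rewrite sum_derivX_Gpoly -/G in muE.
have nuE := sum_tail_weight_index p k; rewrite sum_deriv2X_Gpoly -/G in nuE.
have mu_gt0 : 0 < \sum_(0 <= i < k) tail_weight p k i.
  rewrite big_ltn // [tail_weight _ _ _]p_sum1 ltr_wpDr // sumr_ge0 // => i _.
  by rewrite sumr_ge0 // => a _; rewrite exprn_ge0 // ltW.
have G1_neq0 : (G^`()).[sigma] != 0.
  by move: mu_gt0; rewrite muE pmulr_rgt0 // => /gt_eqF ->.
(* Now mu = sigma G'(sigma) and 2 nu = sigma^2 G''(sigma): the powers of sigma cancel in 2 p_j nu /
   mu^2, while p_j / mu keeps a factor 1/sigma = phi. *)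
rewrite -[2 * p j * _]mulrA [2 * _]mulrCA nuE muE.
have -> : phi ^ (- j%:Z) = p j by rewrite -invr_expz pE.
have -> : phi ^ (1 - j%:Z) = p j / sigma.
  by rewrite expfzDr // -invr_expz pE -/(p j) expr1z sigmaE invrK mulrC.
rewrite le_eqVlt; apply/orP; left; apply/eqP; congr (`|_ - _|).
by field; rewrite G1_neq0 gt_eqF.
Qed.
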